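(* Let $G$ be a finite group, let $\mathcal{H}$ be a finite-dimensional Hilbert space carrying a projective unitary representation $U$ of $G$, let $\rho\in\mathcal{S}(\mathcal{H})$ be a state, and let $S:=\{g\in G \mid \mathcal{U}_g(\rho)=\rho\}$ be its symmetry subgroup, where $\mathcal{U}_g(\cdot)=U(g)\,\cdot\,U(g)^\dagger$. Let $\epsilon\in[0,1)$ and let $\Delta$ be a distinguishability measure whose orthogonal distinguishability function $f_\Delta$ is strictly increasing. Then the following statements are equivalent: (i) For every $S$-covariant CPTP map $\mathcal{E}$ (between any two systems $X$, $Y$ carrying projective unitary representations of $G$), there exists a $G$-covariant CPTP map $\mathcal{F}$ from $X\otimes\mathcal{H}$ to $Y$ such that for every state $\chi$ on $X$, $\Delta(\mathcal{E}(\chi),\mathcal{F}(\chi\otimes\rho))\le f_\Delta(-\log(1-\epsilon))$. (ii) For every $S$-invariant state $\sigma$ (on any system carrying a projective unitary representation of $G$), there exists a $G$-covariant CPTP map $\mathcal{F}$ such that $\Delta(\sigma,\mathcal{F}(\rho))\le f_\Delta(-\log(1-\epsilon))$. (iii) There exists a $G$-covariant CPTP map $\mathcal{F}$ from $\mathcal{H}$ to the left regular representation space such that $\Delta(\tau_S,\mathcal{F}(\rho))\le f_\Delta(-\log(1-\epsilon))$. (iv) There exists a POVM $\{M_x\}_{x\in G/S}$ on $\mathcal{H}$ such that $\min_{g\in G}\mathrm{tr}(\mathcal{U}_g(\rho)M_{gS})\ge 1-\epsilon$. (v) There exists a POVM $\{M_x\}_{x\in G/S}$ on $\mathcal{H}$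 such that $\frac{1}{|G|}\sum_{g\in G}\mathrm{tr}(\mathcal{U}_g(\rho)M_{gS})\ge 1-\epsilon$.
   Context: All Hilbert spaces are finite-dimensional; $\mathcal{S}(\mathcal{H})$ denotes the density operators on $\mathcal{H}$. Systems carry projective unitary representations of $G$; the representation on a composite system is the tensor product of those of its constituents. The one-dimensional system with the trivial representation is allowed. For a subgroup $T\subset G$, a CPTP map $\mathcal{E}$ from a system with representation $U_1$ to a system with representation $U_2$ is $T$-covariant if $\mathcal{E}(U_1(g)LU_1(g)^\dagger)=U_2(g)\mathcal{E}(L)U_2(g)^\dagger$ for all $g\in T$ and all operators $L$. A state $\sigma$ is $T$-invariant if $U(g)\sigma U(g)^\dagger=\sigma$ for all $g\in T$. $G/S$ is the set of left cosets. A distinguishability measure $\Delta$ is a family of functions $\Delta_{\mathcal{H}}:\mathcal{S}(\mathcal{H})\times\mathcal{S}(\mathcal{H})\to[0,\infty]$, one for each finite-dimensional Hilbert space $\mathcal{H}$ (subscript omitted), such that $\Delta(\rho,\sigma)\ge\Delta(\mathcal{E}(\rho),\mathcal{E}(\sigma))$ for all states $\rho,\sigma$ on $\mathcal{H}$ and all CPTP maps $\mathcal{E}:\mathcal{L}(\mathcal{H})\to\mathcal{L}(\mathcal{H}')$. The orthogonal distinguishability function $f_\Delta:[0,\infty]\to[0,\infty]$ is $f_\Delta(x):=\Delta(\rho_0,e^{-x}\rho_0+(1-e^{-x})\sigma_0)$, where $\rho_0,\sigma_0$ is any pair of orthogonal states (the value does not depend on the choice of the pair or of the Hilbert space). The left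 regular representation space has orthonormal basis $\{|\xi_g\rangle\}_{g\in G}$ and representation $L(g)|\xi_h\rangle=|\xi_{gh}\rangle$. For a subgroup $S\subset G$, $\tau_S:=\frac{1}{|S|}\sum_{s\in S}|\xi_s\rangle\langle\xi_s|$. *)

(* Defs.v *)
From HB Require Import structures.
From mathcomp Require Import all_boot all_order all_algebra all_fingroup.
From mathcomp Require Import spectral.
From mathcomp Require Import complex.
From mathcomp Require mxtens.
From mathcomp Require Import reals constructive_ereal exp.

Set Implicit Arguments.
Unset Strict Implicit.
Unset Printing Implicit Defensive.

Import Order.TTheory GRing.Theory Num.Theory.
Local Open Scope ring_scope.
Local Open Scope complex_scope.
Local Open Scope sesquilinear_scope.

(* An n-dimensional Hilbert space is R[i]^n (column vectors) with its standard
   inner product, operators are matrices, and a tensor product of systems is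
   the Kronecker product. mxtens is not imported because its notation
   "A ^t k" clashes with the one used for the adjoint "M ^t*". *)
Notation "A *t B" := (mxtens.tensmx A B)
  (at level 40, left associativity, format "A  *t  B") : ring_scope.

Section Operators.
Variable R : realType.

(* Over R[i], "0 <= z" says that z is real and nonnegative, so psd A entails
   that A is Hermitian. *)
Definition psd n (A : 'M[R[i]]_n) : Prop :=
  forall v : 'cV[R[i]]_n, 0 <= (v ^t* *m A *m v) 0 0.

Definition state n (rho : 'M[R[i]]_n) : Prop := psd rho /\ \tr rho = 1.

(* block i j A is (<i| (x) 1) A (|j> (x) 1). *)
Definition block k m (i j : 'I_k) (A : 'M[R[i]]_(k * m)) : 'M[R[i]]_m :=
  \matrix_(a, b) A (mxtens.mxtens_index (i, a)) (mxtens.mxtens_index (j, b)).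

(* ampl k E is id_k (x) E; see ampl_tens. *)
Definition ampl k m n (E : 'M[R[i]]_m -> 'M[R[i]]_n) (A : 'M[R[i]]_(k * m)) :
    'M[R[i]]_(k * n) :=
  \sum_(i < k) \sum_(j < k) delta_mx i j *t E (block i j A).

Lemma ampl_tens k m n (E : {linear 'M[R[i]]_m -> 'M[R[i]]_n})
    (B : 'M[R[i]]_k) (A : 'M[R[i]]_m) :
  ampl E (B *t A) = B *t E A.
Proof.
apply/matrixP => x y.
case: (mxtens.mxtens_indexP x) => i a; case: (mxtens.mxtens_indexP y) => j b.
rewrite !mxtens.tensmxE summxE (bigD1 i) //= summxE (bigD1 j) //=.
rewrite mxtens.tensmxE mxE !eqxx mul1r.
have -> : block i j (B *t A) = B i j *: A.
  by apply/matrixP => c d; rewrite !mxE !mxtens.mxtens_indexK.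
rewrite linearZ mxE big1 ?addr0; last first.
  by move=> l lj; rewrite mxtens.tensmxE mxE eq_sym (negPf lj) andbF mul0r.
rewrite big1 ?addr0 // => l li; rewrite summxE big1 // => l' _.
by rewrite mxtens.tensmxE mxE eq_sym (negPf li) mul0r.
Qed.

Definition completely_positive m n (E : 'M[R[i]]_m -> 'M[R[i]]_n) : Prop :=
  forall k (A : 'M[R[i]]_(k * m)), psd A -> psd (ampl E A).

Definition trace_preserving m n (E : 'M[R[i]]_m -> 'M[R[i]]_n) : Prop :=
  forall L, \tr (E L) = \tr L.

Definition cptp m n (E : {linear 'M[R[i]]_m -> 'M[R[i]]_n}) : Prop :=
  completely_positive E /\ trace_preserving E.

Definition povm (X : finType) (D : {set X}) n (M : X -> 'M[R[i]]_n) : Prop :=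
  (forall x, x \in D -> psd (M x)) /\ \sum_(x in D) M x = 1%:M.

(* tr (rho M) as a real number; its imaginary part vanishes when rho and M are
   positive semidefinite. *)
Definition outcome_prob n (rho M : 'M[R[i]]_n) : R :=
  complex.Re (\tr (rho *m M)).

End Operators.

Section Symmetry.
Variables (R : realType) (gT : finGroupType).

Definition proj_unitary_rep n (U : gT -> 'M[R[i]]_n) : Prop :=
  (forall g, U g \is unitarymx) /\
  (forall g h, exists2 c : R[i],
     `|c| = 1 & U g *m U h = c *: U (g * h)%g).

Definition conj_act n (U : gT -> 'M[R[i]]_n) (g : gT) (L : 'M[R[i]]_n) :
    'M[R[i]]_n :=
  U g *m L *m (U g) ^t*.

Definition covariant (T : {set gT}) m n
    (U1 : gT -> 'M[R[i]]_m) (U2 : gT -> 'M[R[i]]_n)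
    (E : 'M[R[i]]_m -> 'M[R[i]]_n) : Prop :=
  forall g, g \in T -> forall L, E (conj_act U1 g L) = conj_act U2 g (E L).

Definition invariant_state (T : {set gT}) n (U : gT -> 'M[R[i]]_n)
    (sigma : 'M[R[i]]_n) : Prop :=
  state sigma /\ forall g, g \in T -> conj_act U g sigma = sigma.

Definition sym_subgroup n (U : gT -> 'M[R[i]]_n) (rho : 'M[R[i]]_n) :
    {set gT} :=
  [set g | conj_act U g rho == rho].

Definition tens_rep m n (U : gT -> 'M[R[i]]_m) (V : gT -> 'M[R[i]]_n) (g : gT) :
    'M[R[i]]_(m * n) :=
  U g *t V g.

(* The basis vector xi_g of the regular representation space is the standard
   basis vector of index enum_rank g. *)
Definition left_regular (g : gT) : 'M[R[i]]_#|gT| :=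
  \matrix_(a, b) (enum_val a == (g * enum_val b)%g)%:R.

Definition tau (S : {set gT}) : 'M[R[i]]_#|gT| :=
  #|S|%:R^-1 *: \sum_(s in S) delta_mx (enum_rank s) (enum_rank s).

(* The minimum of p over the group: the base value p 1 is one of the values. *)
Definition min_over_group (p : gT -> R) : R :=
  \big[Order.min/p 1%g]_(g : gT) p g.

End Symmetry.

Arguments left_regular R {gT} g.
Arguments tau R {gT} S.

Section Distinguishability.
Variable R : realType.
Local Open Scope ereal_scope.

(* Values of Delta outside pairs of states are unconstrained and never used. *)
Definition distinguishability_measure
    (Delta : forall n, 'M[R[i]]_n -> 'M[R[i]]_n -> \bar R) : Prop :=
  (forall n (rho sigma : 'M[R[i]]_n),
     state rho -> state sigma -> 0 <= Delta n rho sigma) /\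
  (forall m n (E : {linear 'M[R[i]]_m -> 'M[R[i]]_n}), cptp E ->
     forall rho sigma : 'M[R[i]]_m, state rho -> state sigma ->
     Delta n (E rho) (E sigma) <= Delta m rho sigma).

Definition orthogonal_states n (rho0 sigma0 : 'M[R[i]]_n) : Prop :=
  [/\ state rho0, state sigma0 & rho0 *m sigma0 = 0%R].

(* expeR (- x) is real for x in [0, +oo], with value 0 at +oo. *)
Definition orth_dist_fun
    (Delta : forall n, 'M[R[i]]_n -> 'M[R[i]]_n -> \bar R)
    n (rho0 sigma0 : 'M[R[i]]_n) (x : \bar R) : \bar R :=
  let p := fine (expeR (- x)) in
  Delta n rho0 (p%:C *: rho0 + (1 - p)%:C *: sigma0)%R.

Definition strictly_increasing_ge0 (f : \bar R -> \bar R) : Prop :=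
  forall x y, 0 <= x -> x < y -> f x < f y.

End Distinguishability.

(* Main.v *)
(* (i) => (ii) => (iii) specialise the channel to a state preparation and the
   state to tau_S.  For (iii) => (iv), measuring whether the regular system lies
   in the coset S, and preparing rho0 or sigma0 accordingly, maps tau_S to rho0
   and F(rho) to p rho0 + (1 - p) sigma0; since f_Delta is strictly increasing,
   data processing forces p >= 1 - epsilon, and pulling the coset measurement
   back along F gives a POVM of success probability p at every g.  For
   (v) => (i), F measures the reference system, applies E conjugated by a
   representative of the outcome coset (well defined by S-covariance), and is
   then twirled over G; F(chi (x) rho) is E(chi) mixed with another state, with
   weight the average success probability, and the distance of such a mixture
   to E(chi) is bounded by f_Delta through a channel sending rho0 to E(chi) and
   sigma0 to that other state. *)
Require Import Defs.
From HB Require Import structures.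
From mathcomp Require Import all_boot all_order all_algebra all_fingroup.
From mathcomp Require Import spectral.
From mathcomp Require Import complex.
From mathcomp Require Import reals constructive_ereal exp.

Set Implicit Arguments.
Unset Strict Implicit.
Unset Printing Implicit Defensive.

Import Order.TTheory GRing.Theory Num.Theory.
Local Open Scope ring_scope.

(** * Adjoints, Kronecker products and traces of matrix units *)

Section Adjoint.
Local Open Scope sesquilinear_scope.

Lemma adjmx_mul (C : numClosedFieldType) m n p (A : 'M[C]_(m, n)) (B : 'M_(n, p)) :
  (A *m B) ^t* = B ^t* *m A ^t*.
Proof. by rewrite trmx_mul map_mxM. Qed.

Lemma adjmx_tens (C : numClosedFieldType) m n p q (A : 'M[C]_(m, n))
    (B : 'M_(p, q)) :
  (A *t B) ^t* = A ^t* *t B ^t*.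
Proof. by rewrite mxtens.trmx_tens mxtens.map_mxT. Qed.

Lemma adjmx1 (C : numClosedFieldType) n : (1%:M : 'M[C]_n) ^t* = 1%:M.
Proof. by rewrite trmx1 map_mx1. Qed.

Lemma tensmx1 (C : pzRingType) m n : 1%:M *t 1%:M = 1%:M :> 'M[C]_(m * n).
Proof.
apply/matrixP => x y.
case: (mxtens.mxtens_indexP x) => i a; case: (mxtens.mxtens_indexP y) => j b.
rewrite mxtens.tensmxE !mxE (inj_eq (can_inj (@mxtens.mxtens_indexK _ _))).
by rewrite xpair_eqE -natrM mulnb.
Qed.

Lemma mxtrace_delta (C : pzRingType) n (i j : 'I_n) :
  \tr (delta_mx i j : 'M[C]_n) = (i == j)%:R.
Proof.
rewrite /mxtrace (bigD1 i) //= mxE eqxx big1 ?addr0 // => k ki.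
by rewrite mxE (negPf ki).
Qed.

End Adjoint.

(** * Positive semidefinite operators and completely positive maps *)

Section Operators.
Variable R : realType.
Local Open Scope sesquilinear_scope.
Local Notation C := (R[i]).

Lemma psd_conj m n (K : 'M[C]_(m, n)) (A : 'M[C]_n) :
  psd A -> psd (K *m A *m K ^t*).
Proof.
move=> hA v; have := hA (K ^t* *m v).
by rewrite adjmx_mul trmxCK !mulmxA.
Qed.

Lemma psdD n (A B : 'M[C]_n) : psd A -> psd B -> psd (A + B).
Proof. by move=> hA hB v; rewrite mulmxDr mulmxDl mxE addr_ge0. Qed.

Lemma psd0 n : psd (0 : 'M[C]_n).
Proof. by move=> v; rewrite mulmx0 mul0mx mxE. Qed.

Lemma psd_sum (I : finType) (P : pred I) n (A : I -> 'M[C]_n) :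
  (forall i, P i -> psd (A i)) -> psd (\sum_(i | P i) A i).
Proof.
by move=> hA; elim/big_ind: _ => [|B D|]; [apply: psd0|apply: psdD|apply: hA].
Qed.

Lemma psdZ n (c : C) (A : 'M[C]_n) : 0 <= c -> psd A -> psd (c *: A).
Proof.
by move=> hc hA v; rewrite -scalemxAr -scalemxAl mxE mulr_ge0.
Qed.

Lemma psd_gram m n (B : 'M[C]_(m, n)) : psd (B ^t* *m B).
Proof.
move=> v; rewrite mulmxA -mulmxA -adjmx_mul mxE sumr_ge0 // => i _.
by rewrite !mxE mulrC mul_conjC_ge0.
Qed.

Lemma psd1 n : psd (1%:M : 'M[C]_n).
Proof. by rewrite -[1%:M]mulmx1 -{1}adjmx1; apply: psd_gram. Qed.

Lemma psd_diag_ge0 n (A : 'M[C]_n) i : psd A -> 0 <= A i i.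
Proof.
move=> /(_ (delta_mx i 0)); rewrite trmx_delta map_delta_mx.
by rewrite -rowE -colE !mxE.
Qed.

Lemma psd_trace_ge0 n (A : 'M[C]_n) : psd A -> 0 <= \tr A.
Proof. by move=> hA; apply: sumr_ge0 => i _; apply: psd_diag_ge0. Qed.

(** The last clause writes each eigenvalue as the quadratic form of [A] at the eigenvector
    [P^* e_i], so a sign or vanishing condition on the form passes directly to the spectrum. *)
Lemma normalmx_diag n (A : 'M[C]_n) : A \is normalmx ->
  exists2 P : 'M[C]_n, P \is unitarymx &
    exists d : 'rV[C]_n, A = P ^t* *m diag_mx d *m P /\
      forall i, d 0 i = ((P ^t* *m delta_mx i (0 : 'I_1)) ^t* *m A *m
                         (P ^t* *m delta_mx i (0 : 'I_1))) 0 0.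
Proof.
move=> /orthomx_spectralP; set P := spectralmx A; set d := spectral_diag A.
have uP : P \is unitarymx by apply: spectral_unitarymx.
rewrite invmx_unitary // => eA; exists P => //; exists d; split=> // i.
have PP : P *m P ^t* = 1%:M by apply/unitarymxP.
rewrite [in RHS]eA adjmx_mul trmxCK !mulmxA.
rewrite -[_ *m P *m P ^t*]mulmxA PP mulmx1.
rewrite -[_ *m P *m P ^t*]mulmxA PP mulmx1.
rewrite trmx_delta map_delta_mx -rowE -colE !mxE eqxx.
by rewrite mulr1n.
Qed.

(* A - A^* is normal with vanishing quadratic form, hence zero. *)
Lemma psd_hermitian n (A : 'M[C]_n) : psd A -> A ^t* = A.
Proof.
move=> hA; set B := A - A ^t*.
have Bq (v : 'cV[C]_n) : (v ^t* *m B *m v) 0 0 = 0.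
  rewrite mulmxBr mulmxBl !mxE; set x := (X in X - _); set y := (X in _ - X).
  have -> : y = x^*.
    have xE : x = (v ^t* *m A *m v) 0 0 by rewrite [RHS]mxE.
    have yE : y = (v ^t* *m A ^t* *m v) 0 0 by rewrite [RHS]mxE.
    have -> : x^* = ((v ^t* *m A *m v) ^t*) 0 0 by rewrite xE [RHS]mxE [in RHS]mxE.
    by rewrite yE !adjmx_mul trmxCK mulmxA.
  suff -> : x^* = x by rewrite subrr.
  by apply/CrealP/ger0_real; have := hA v; rewrite [X in 0 <= X]mxE.
have Badj : B ^t* = - B.
  by rewrite linearB /= map_mxB trmxCK opprB.
have /normalmx_diag [P uP [d [BE dE]]] : B \is normalmx.
  by apply/normalmxP; rewrite Badj mulmxN mulNmx.
have d0 : d = 0 by apply/rowP => i; rewrite dE Bq mxE.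
have : B = 0 by rewrite BE d0 linear0 mulmx0 mul0mx.
by move/eqP; rewrite subr_eq0 => /eqP.
Qed.

Lemma psd_spectral n (A : 'M[C]_n) : psd A ->
  exists2 P : 'M[C]_n, P \is unitarymx &
    exists2 d : 'rV[C]_n, A = P ^t* *m diag_mx d *m P & forall i, 0 <= d 0 i.
Proof.
move=> hA; have /normalmx_diag [P uP [d [AE dE]]] : A \is normalmx.
  by apply/normalmxP; rewrite psd_hermitian.
by exists P => //; exists d => // i; rewrite dE.
Qed.

(** The factor is the diagonal of entrywise square roots; these are real because the entries are
    nonnegative, so the factor is its own adjoint. *)
Lemma psd_diag_mx n (d : 'rV[C]_n) : (forall i, 0 <= d 0 i) ->
  exists B : 'M[C]_n, diag_mx d = B ^t* *m B.
Proof.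
move=> d0; exists (diag_mx (map_mx sqrtC d)).
rewrite tr_diag_mx map_diag_mx mulmx_diag; congr diag_mx; apply/rowP => i.
rewrite !mxE -{1}[d 0 i]sqrtCK expr2; congr (_ * _); symmetry.
by apply/CrealP; rewrite ger0_real ?sqrtC_ge0.
Qed.

Lemma psd_factor n (A : 'M[C]_n) : psd A -> exists B : 'M[C]_n, A = B ^t* *m B.
Proof.
move=> /psd_spectral [P uP [d -> /psd_diag_mx [B ->]]].
by exists (B *m P); rewrite adjmx_mul !mulmxA.
Qed.

(** With [B = K^* K], cyclicity turns the trace into that of [K A K^*], which is positive
    semidefinite. *)
Lemma psd_trace_mul_ge0 n (A B : 'M[C]_n) : psd A -> psd B -> 0 <= \tr (A *m B).
Proof.
move=> hA /psd_factor [K ->]; rewrite mulmxA mxtrace_mulC mulmxA.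
exact/psd_trace_ge0/psd_conj.
Qed.

Lemma psd_trace_eq0 n (A : 'M[C]_n) : psd A -> \tr A = 0 -> A = 0.
Proof.
move=> /psd_spectral [P uP [d AE d0]].
have PP : P *m P ^t* = 1%:M by apply/unitarymxP.
rewrite AE mxtrace_mulC mulmxA PP mul1mx mxtrace_diag => /eqP.
rewrite psumr_eq0 // => /allP dz.
suff -> : d = 0 by rewrite linear0 mulmx0 mul0mx.
by apply/rowP => i; rewrite mxE; apply/eqP/dz; rewrite mem_index_enum.
Qed.

(* [P] is the projector onto the support of [A]. *)
Lemma orthogonal_test n (A B : 'M[C]_n) : psd A -> A *m B = 0 ->
  exists2 P : 'M[C]_n, psd P /\ psd (1%:M - P) & P *m A = A /\ P *m B = 0.
Proof.
move=> /psd_spectral [Q uQ [d AE d0]] AB.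
have QQ : Q *m Q ^t* = 1%:M by apply/unitarymxP.
have QQ' : Q ^t* *m Q = 1%:M by apply: mulmx1C.
(* Functional calculus of [A]: products and differences of the matrices [D f] become pointwise
   operations on the functions, and the projector is the indicator of the nonzero spectrum. *)
pose D (f : C -> C) := Q ^t* *m diag_mx (map_mx f d) *m Q.
have Deq f g : (forall x, f x = g x) -> D f = D g.
  by move=> fg; rewrite /D (eq_map_mx _ fg).
have DM f g : D f *m D g = D (fun x => f x * g x).
  rewrite /D -!mulmxA [Q *m (Q ^t* *m _)]mulmxA QQ mul1mx.
  rewrite [diag_mx _ *m (diag_mx _ *m _)]mulmxA mulmx_diag.
  rewrite (_ : (\row_j _) = map_mx (fun x => f x * g x) d) //.
  by apply/rowP => i; rewrite !mxE.
have DB f g : D f - D g = D (fun x => f x - g x).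
  rewrite /D -mulmxBl -mulmxBr -linearB.
  rewrite (_ : map_mx f d - map_mx g d = map_mx (fun x => f x - g x) d) //.
  by apply/rowP => i; rewrite !mxE.
have D1 : D (fun=> 1) = 1%:M.
  rewrite /D (_ : map_mx _ d = const_mx 1) ?diag_const_mx ?mulmx1 //.
  by apply/rowP => i; rewrite !mxE.
have AD : A = D id.
  by rewrite AE /D (_ : map_mx id d = d) //; apply/rowP => i; rewrite mxE.
have Dpsd f : (forall x, 0 <= f x) -> psd (D f).
  move=> f0; rewrite /D -{2}[Q]trmxCK; apply: psd_conj.
  by have [|E ->] := @psd_diag_mx n (map_mx f d);
    [move=> i; rewrite mxE|apply: psd_gram].
exists (D (fun x => (x != 0)%:R)); split.
- by apply: Dpsd => x; rewrite ler0n.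
- rewrite -D1 DB; apply: Dpsd => x.
  by case: eqP => _; rewrite ?subr0 ?subrr ?ler01.
- rewrite AD DM; apply: Deq => x.
  by case: eqP => [->|_]; rewrite ?mulr0 ?mul1r.
(* Since [0^-1 = 0], the indicator of [x != 0] is [x^-1 * x]; so [P] is a pseudo-inverse of [A]
   times [A], and [A B = 0] gives [P B = 0]. *)
- rewrite (Deq _ (fun x => x^-1 * x)) => [|x]; last first.
    by case: eqP => [->|/eqP h]; rewrite ?mulr0 ?mulVf.
  by rewrite -(DM _ id) -AD -mulmxA AB mulmx0.
Qed.

Lemma psd_tens m n (A : 'M[C]_m) (B : 'M[C]_n) : psd A -> psd B -> psd (A *t B).
Proof.
move=> /psd_factor [X ->] /psd_factor [Y ->].
by rewrite -mxtens.tensmx_mul -adjmx_tens; apply: psd_gram.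
Qed.

(** Selecting rows and columns is conjugation by a 0/1 matrix. Extraction of a diagonal block,
    relabelling of indices and the regular representation all get their positivity from this
    form. *)
Lemma mxsub_conj m n (g : 'I_m -> 'I_n) (A : 'M[C]_n) :
  mxsub g g A = rowsub g 1%:M *m A *m (rowsub g 1%:M) ^t*.
Proof.
have -> : (rowsub g 1%:M : 'M[C]_(m, n)) ^t* = colsub g 1%:M.
  by apply/matrixP => i j; rewrite !mxE eq_sym conjC_nat.
by rewrite -[A in LHS]mulmx1 mxsub_mul [rowsub g A]rowsubE.
Qed.

Lemma psd_mxsub m n (g : 'I_m -> 'I_n) (A : 'M[C]_n) : psd A -> psd (mxsub g g A).
Proof. by move=> hA; rewrite mxsub_conj; apply: psd_conj. Qed.

(** * Blocks, ampliations and complete positivity *)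

Lemma blockP k m (A B : 'M[C]_(k * m)) :
  (forall i j, block i j A = block i j B) -> A = B.
Proof.
move=> AB; apply/matrixP => x y.
case: (mxtens.mxtens_indexP x) => i a; case: (mxtens.mxtens_indexP y) => j b.
by have /matrixP/(_ a b) := AB i j; rewrite !mxE.
Qed.

Lemma block_tens k m (A : 'M[C]_k) (B : 'M[C]_m) i j : block i j (A *t B) = A i j *: B.
Proof. by apply/matrixP => a b; rewrite mxE mxtens.tensmxE mxE. Qed.

Lemma block_sum k m (I : finType) (P : pred I) (A : I -> 'M[C]_(k * m)) i j :
  block i j (\sum_(x | P x) A x) = \sum_(x | P x) block i j (A x).
Proof.
by apply/matrixP => a b; rewrite mxE !summxE; apply: eq_bigr => x _; rewrite mxE.
Qed.

Lemma blockZ k m (c : C) (A : 'M[C]_(k * m)) i j :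
  block i j (c *: A) = c *: block i j A.
Proof. by apply/matrixP => a b; rewrite !mxE. Qed.

Lemma blockD k m (A B : 'M[C]_(k * m)) i j :
  block i j (A + B) = block i j A + block i j B.
Proof. by apply/matrixP => a b; rewrite !mxE. Qed.

(** Together with [blockP], this reduces an identity between ampliations to one between the maps
    themselves. It holds for plain functions, so closure properties of complete positivity can be
    proved apart from linearity. *)
Lemma block_ampl k m n (E : 'M[C]_m -> 'M[C]_n) (A : 'M[C]_(k * m)) i j :
  block i j (ampl E A) = E (block i j A).
Proof.
rewrite block_sum (bigD1 i) //= block_sum (bigD1 j) //=.
rewrite block_tens mxE !eqxx scale1r big1 ?addr0 => [|l lj]; last first.
  by rewrite block_tens mxE [j == l]eq_sym (negPf lj) andbF scale0r.
rewrite big1 ?addr0 // => l li; rewrite block_sum big1 // => l' _.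
by rewrite block_tens mxE eq_sym (negPf li) scale0r.
Qed.

Lemma ampl_id k m (A : 'M[C]_(k * m)) : ampl id A = A.
Proof. by apply: blockP => i j; rewrite block_ampl. Qed.

Lemma mulmx_sum2 m n p q (I J : finType) (K : 'M[C]_(m, n)) (L : 'M_(p, q))
    (A : I -> J -> 'M_(n, p)) :
  K *m (\sum_i \sum_j A i j) *m L = \sum_i \sum_j K *m A i j *m L.
Proof.
rewrite mulmx_sumr mulmx_suml; apply: eq_bigr => i _.
by rewrite mulmx_sumr mulmx_suml.
Qed.

(** Expanding [A] as [ampl id A], a sum of matrix units tensored with blocks, lets the conjugation
    act on each term separately. *)
Lemma ampl_conj k m n (K : 'M[C]_(n, m)) (A : 'M[C]_(k * m)) :
  ampl (fun L => K *m L *m K ^t*) A = (1%:M *t K) *m A *m (1%:M *t K) ^t*.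
Proof.
rewrite -[A in RHS]ampl_id /ampl mulmx_sum2.
apply: eq_bigr => i _; apply: eq_bigr => j _.
by rewrite adjmx_tens adjmx1 !mxtens.tensmx_mul mul1mx mulmx1.
Qed.

Lemma cp_conj m n (K : 'M[C]_(n, m)) : completely_positive (fun L => K *m L *m K ^t*).
Proof. by move=> k A hA; rewrite ampl_conj; apply: psd_conj. Qed.

Lemma cp_ext m n (E F : 'M[C]_m -> 'M[C]_n) :
  E =1 F -> completely_positive E -> completely_positive F.
Proof.
move=> EF hE k A /hE; congr (psd _).
by apply: blockP => i j; rewrite !block_ampl.
Qed.

Lemma cp_comp m n p (E : 'M[C]_m -> 'M[C]_n) (F : 'M[C]_n -> 'M[C]_p) :
  completely_positive E -> completely_positive F -> completely_positive (F \o E).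
Proof.
move=> hE hF k A /hE/hF; congr (psd _).
by apply: blockP => i j; rewrite !block_ampl.
Qed.

Lemma cp_sum (I : finType) (P : pred I) m n (E : I -> 'M[C]_m -> 'M[C]_n) :
  (forall x, P x -> completely_positive (E x)) ->
  completely_positive (fun L => \sum_(x | P x) E x L).
Proof.
move=> hE k A hA.
have -> : ampl (fun L => \sum_(x | P x) E x L) A = \sum_(x | P x) ampl (E x) A.
  apply: blockP => i j; rewrite block_ampl block_sum.
  by apply: eq_bigr => x _; rewrite block_ampl.
by apply: psd_sum => x Px; apply: hE.
Qed.

Lemma cpZ m n (c : C) (E : 'M[C]_m -> 'M[C]_n) : 0 <= c ->
  completely_positive E -> completely_positive (fun L => c *: E L).
Proof.
move=> c0 hE k A hA; have -> : ampl (fun L => c *: E L) A = c *: ampl E A.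
  by apply: blockP => i j; rewrite blockZ !block_ampl.
exact/psdZ/hE.
Qed.

Lemma cpD m n (E F : 'M[C]_m -> 'M[C]_n) : completely_positive E ->
  completely_positive F -> completely_positive (fun L => E L + F L).
Proof.
move=> hE hF k A hA; have -> : ampl (fun L => E L + F L) A = ampl E A + ampl F A.
  by apply: blockP => i j; rewrite blockD !block_ampl.
by apply: psdD; [apply: hE|apply: hF].
Qed.

Lemma cp_mxsub m n (g : 'I_m -> 'I_n) :
  completely_positive (fun L : 'M[C]_n => mxsub g g L).
Proof. by apply: (cp_ext _ (cp_conj (rowsub g 1%:M))) => L; rewrite -mxsub_conj. Qed.

(** Complete positivity is applied with a one-dimensional ancilla, and [E A] is the only block of
    the result. *)
Lemma cp_psd m n (E : 'M[C]_m -> 'M[C]_n) A :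
  completely_positive E -> psd A -> psd (E A).
Proof.
move=> hE hA; have -> : E A = block 0 0 (ampl E ((1%:M : 'M_1) *t A)).
  by rewrite block_ampl block_tens mxE eqxx scale1r.
have -> k (X : 'M[C]_(k * n)) i :
    block i i X = mxsub (fun a => mxtens.mxtens_index (i, a))
                        (fun a => mxtens.mxtens_index (i, a)) X.
  by apply/matrixP => a b; rewrite !mxE.
by apply/psd_mxsub/hE/psd_tens => //; apply: psd1.
Qed.

(* Tr_2 ((1 (x) M) L) *)
Definition measured p n (M : 'M[C]_n) (L : 'M[C]_(p * n)) : 'M[C]_p :=
  \matrix_(a, b) \tr (M *m block a b L).

Lemma measured_tens p n (M : 'M[C]_n) (A : 'M[C]_p) (B : 'M[C]_n) :
  measured M (A *t B) = \tr (M *m B) *: A.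
Proof.
by apply/matrixP => a b; rewrite !mxE block_tens -scalemxAr mxtraceZ mulrC.
Qed.

Lemma measured_is_linear p n (M : 'M[C]_n) : linear (@measured p n M).
Proof.
move=> c A B; apply/matrixP => a b; rewrite !mxE blockD blockZ mulmxDr mxtraceD.
by rewrite -scalemxAr mxtraceZ.
Qed.

(** If [M = B^* B] and [b_i] are the rows of [B], the map is the sum of the conjugations by
    [1 (x) b_i]; [g] identifies ['I_p] with ['I_(p * 1)]. *)
Lemma cp_measured p n (M : 'M[C]_n) : psd M -> completely_positive (@measured p n M).
Proof.
case/psd_factor => B ->; pose g (a : 'I_p) := mxtens.mxtens_index (a, 0 : 'I_1).
pose K i : 'M[C]_(p * 1, p * n) := 1%:M *t row i B.
apply: (@cp_ext _ _ (fun L => \sum_i mxsub g g (K i *m L *m (K i) ^t*))).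
  move=> L; apply/matrixP => a b; rewrite summxE mxE -mulmxA mxtrace_mulC.
  apply: eq_bigr => i _; rewrite mxE.
  have -> (X : 'M[C]_(p * 1)) : X (g a) (g b) = block a b X 0 0 by rewrite mxE.
  rewrite /K -ampl_conj block_ampl -row_mul [LHS]mxE [RHS]mxE.
  by apply: eq_bigr => j _; rewrite [in LHS]mxE; congr (_ * _); rewrite !mxE.
by apply: cp_sum => i _; apply: (cp_comp (cp_conj (K i)) (@cp_mxsub _ _ g)).
Qed.

Lemma mxtrace_block p n (L : 'M[C]_(p * n)) : \tr L = \sum_a \tr (block a a L).
Proof.
rewrite /mxtrace pair_big /=.
rewrite (reindex (@mxtens.mxtens_index p n)) /=; last first.
  by exists (@mxtens.mxtens_unindex p n) => ? _;
    rewrite ?mxtens.mxtens_indexK ?mxtens.mxtens_unindexK.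
by apply: eq_bigr => -[a b] _; rewrite mxE.
Qed.

Lemma mxtrace_tens p n (A : 'M[C]_p) (B : 'M[C]_n) : \tr (A *t B) = \tr A * \tr B.
Proof.
rewrite mxtrace_block mulr_suml; apply: eq_bigr => a _.
by rewrite block_tens mxtraceZ.
Qed.

Lemma mxtrace_measured p (X : finType) (D : {set X}) n (M : X -> 'M[C]_n)
    (L : 'M[C]_(p * n)) :
  \sum_(x in D) M x = 1%:M -> \sum_(x in D) \tr (measured (M x) L) = \tr L.
Proof.
move=> M1; rewrite mxtrace_block exchange_big; apply: eq_bigr => a _ /=.
under eq_bigr do rewrite mxE.
by rewrite -raddf_sum -mulmx_suml M1 mul1mx.
Qed.

(** The ampliation measures the second factor and tensors what remains with [A], so positivity
    follows from that of [measured] and of Kronecker products. *)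
Lemma cp_measure_prepare m n (M : 'M[C]_m) (A : 'M[C]_n) : psd M -> psd A ->
  completely_positive (fun L => \tr (M *m L) *: A).
Proof.
move=> hM hA k X hX; have -> : ampl (fun L => \tr (M *m L) *: A) X = measured M X *t A.
  by apply: blockP => i j; rewrite block_ampl block_tens mxE.
exact/psd_tens/hA/cp_psd/hX/cp_measured.
Qed.

(** Linearity is a predicate here, so that channels can be written as plain functions and composed;
    [channel_bundle] and [cptp_channel] translate to and from bundled linear maps. *)
Definition channel m n (f : 'M[C]_m -> 'M[C]_n) :=
  [/\ linear f, completely_positive f & trace_preserving f].

Lemma channel_bundle m n (f : 'M[C]_m -> 'M[C]_n) : channel f ->
  exists2 F : {linear 'M[C]_m -> 'M[C]_n}, cptp F & F =1 f.
Proof.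
case=> flin fcp ftp; pose h := GRing.isLinear.Build C 'M[C]_m 'M[C]_n *:%R f flin.
pose F : {linear 'M[C]_m -> 'M[C]_n} := HB.pack f h.
by exists F.
Qed.

Lemma cptp_channel m n (F : {linear 'M[C]_m -> 'M[C]_n}) : cptp F -> channel F.
Proof. by case=> ? ?; split=> //; exact: linearP. Qed.

Lemma channel_state m n (f : 'M[C]_m -> 'M[C]_n) A :
  channel f -> state A -> state (f A).
Proof. by case=> _ fcp ftp [A0 A1]; split; [apply: cp_psd|rewrite ftp]. Qed.

Lemma channel_comp m n p (f : 'M[C]_m -> 'M[C]_n) (g : 'M[C]_n -> 'M[C]_p) :
  channel f -> channel g -> channel (g \o f).
Proof.
move=> [fl fc ft] [gl gc gt]; split=> [c A B||L] /=.
- by rewrite fl gl.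
- exact: cp_comp.
- by rewrite gt ft.
Qed.

(** This binary test serves in both directions: it carries the orthogonal pair to arbitrary states,
    and it carries [tau R S] back to [rho0]. *)
Lemma channel_measure_prepare m n (P : 'M[C]_m) (A B : 'M[C]_n) :
  psd P -> psd (1%:M - P) -> state A -> state B ->
  channel (fun L => \tr (P *m L) *: A + \tr ((1%:M - P) *m L) *: B).
Proof.
move=> P0 P1 [A0 A1] [B0 B1]; split=> [c K L||L].
- rewrite !mulmxDr !mxtraceD -!scalemxAr !mxtraceZ !scalerDl !scalerDr !scalerA.
  by rewrite addrACA.
- by apply: cpD; apply: cp_measure_prepare.
- by rewrite mxtraceD !mxtraceZ A1 B1 !mulr1 -mxtraceD -mulmxDl addrC subrK mul1mx.
Qed.

End Operators.

(** * Projective representations and the regular representation *)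

Section Symmetry.
Variables (R : realType) (gT : finGroupType).
Local Notation C := (R[i]).
Local Open Scope sesquilinear_scope.

Lemma conj_act_is_linear n (U : gT -> 'M[C]_n) g : linear (conj_act U g).
Proof. by move=> c A B; rewrite /conj_act mulmxDr mulmxDl -scalemxAr -scalemxAl. Qed.

Lemma conj_actZ n (U : gT -> 'M[C]_n) g c A :
  conj_act U g (c *: A) = c *: conj_act U g A.
Proof. by rewrite /conj_act -scalemxAr -scalemxAl. Qed.

Lemma conj_act_sum n (U : gT -> 'M[C]_n) g (I : finType) (P : pred I) A :
  conj_act U g (\sum_(i | P i) A i) = \sum_(i | P i) conj_act U g (A i).
Proof. by rewrite /conj_act mulmx_sumr mulmx_suml. Qed.

Section Rep.
Variables (n : nat) (U : gT -> 'M[C]_n).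
Hypothesis hU : proj_unitary_rep U.

Lemma rep_adjK g : (U g) ^t* *m U g = 1%:M.
Proof. by apply: mulmx1C; apply/unitarymxP; case: hU. Qed.

(** The projective phase enters once with its conjugate and contributes [|c|^2 = 1], so conjugation
    is a genuine action. *)
Lemma conj_actM g h L : conj_act U g (conj_act U h L) = conj_act U (g * h)%g L.
Proof.
have [c c1 Ugh] := hU.2 g h.
rewrite /conj_act; have -> : U g *m (U h *m L *m (U h) ^t*) *m (U g) ^t* =
    (U g *m U h) *m L *m (U g *m U h) ^t* by rewrite adjmx_mul !mulmxA.
rewrite Ugh linearZ /= map_mxZ -!scalemxAl -scalemxAr scalerA.
by rewrite -normCK c1 expr1n scale1r.
Qed.

Lemma conj_act_inj g : injective (conj_act U g).
Proof.
move=> A B /(congr1 (fun X => (U g) ^t* *m X *m U g)).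
by rewrite /conj_act -!mulmxA rep_adjK !mulmx1 !mulmxA rep_adjK !mul1mx.
Qed.

(** A projective representation fixes [U 1] only up to a phase; but conjugation by [U 1] is
    idempotent and injective, hence the identity. *)
Lemma conj_act1 L : conj_act U 1%g L = L.
Proof. by apply: (@conj_act_inj 1%g); rewrite conj_actM mulg1. Qed.

Lemma conj_actK g L : conj_act U g (conj_act U g^-1%g L) = L.
Proof. by rewrite conj_actM mulgV conj_act1. Qed.

Lemma mxtrace_conj_act g L : \tr (conj_act U g L) = \tr L.
Proof. by rewrite /conj_act mxtrace_mulC mulmxA rep_adjK mul1mx. Qed.

Lemma conj_act_mul g A B : conj_act U g A *m conj_act U g B = conj_act U g (A *m B).
Proof.
rewrite /conj_act -!mulmxA; congr (_ *m (_ *m _)).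
by rewrite [(U g) ^t* *m _]mulmxA rep_adjK mul1mx.
Qed.

Lemma channel_conj_act g : channel (conj_act U g).
Proof.
split; [exact: conj_act_is_linear|exact: cp_conj|].
by move=> L; rewrite mxtrace_conj_act.
Qed.

Lemma group_set_sym_subgroup A : group_set (sym_subgroup U A).
Proof.
apply/group_setP; split=> [|g h]; first by rewrite inE conj_act1.
by rewrite !inE -conj_actM => /eqP gA /eqP ->; rewrite gA.
Qed.

End Rep.

Lemma proj_unitary_rep_trivial n : proj_unitary_rep (fun _ : gT => 1%:M : 'M[C]_n).
Proof.
split=> [g|g h]; first by apply/unitarymxP; rewrite adjmx1 mulmx1.
by exists 1; rewrite ?normr1 // mulmx1 scale1r.
Qed.

Lemma proj_unitary_rep_tens m n (U : gT -> 'M[C]_m) (V : gT -> 'M[C]_n) :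
  proj_unitary_rep U -> proj_unitary_rep V -> proj_unitary_rep (tens_rep U V).
Proof.
move=> [U1 UM] [V1 VM]; split=> [g|g h].
  apply/unitarymxP; rewrite adjmx_tens mxtens.tensmx_mul.
  by rewrite (unitarymxP (U1 g)) (unitarymxP (V1 g)) tensmx1.
have [c c1 Ugh] := UM g h; have [d d1 Vgh] := VM g h.
exists (c * d); first by rewrite normrM c1 d1 mulr1.
rewrite mxtens.tensmx_mul Ugh Vgh; apply: blockP => i j.
by rewrite blockZ !block_tens mxE !scalerA mulrAC.
Qed.

Lemma conj_act_tens m n (U : gT -> 'M[C]_m) (V : gT -> 'M[C]_n) g A B :
  conj_act (tens_rep U V) g (A *t B) = conj_act U g A *t conj_act V g B.
Proof. by rewrite /conj_act adjmx_tens !mxtens.tensmx_mul. Qed.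

(** The row of [L(g)] labelled [h] has its 1 in column [g^-1 h]; with the inverse built in,
    conjugation by [L(g)] is a reindexing of rows and columns. *)
Definition left_index (g : gT) (a : 'I_#|gT|) : 'I_#|gT| :=
  enum_rank (g^-1 * enum_val a)%g.

Lemma left_index_inj g : injective (left_index g).
Proof. by move=> a b /enum_rank_inj/mulgI/enum_val_inj. Qed.

Lemma left_regularE g : left_regular R g = rowsub (left_index g) 1%:M.
Proof.
apply/matrixP => a b; rewrite !mxE; congr (_ %:R); congr nat_of_bool.
rewrite -[b in RHS]enum_valK (inj_eq enum_rank_inj).
by rewrite -[in RHS](inj_eq (mulgI g)) mulKVg.
Qed.

Lemma conj_act_left_regular g X :
  conj_act (left_regular R) g X = mxsub (left_index g) (left_index g) X.
Proof. by rewrite mxsub_conj -left_regularE. Qed.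

Lemma proj_unitary_rep_left_regular : proj_unitary_rep (left_regular R (gT := gT)).
Proof.
split=> [g|g h].
  apply/unitarymxP; have := conj_act_left_regular g 1%:M.
  rewrite /conj_act mulmx1 => ->.
  by apply/matrixP => a b; rewrite !mxE (inj_eq (@left_index_inj g)).
exists 1; rewrite ?normr1 // scale1r !left_regularE -rowsubE.
by apply/matrixP => a b; rewrite !mxE /left_index enum_rankK invMg mulgA.
Qed.

(** The diagonal form makes products and complements entrywise computations; [basis_projE] gives the
    sum of rank-one projectors that occurs in [tau]. *)
Definition basis_proj (A : {set gT}) : 'M[C]_#|gT| :=
  diag_mx (\row_a (enum_val a \in A)%:R).

Lemma psd_basis_proj A : psd (basis_proj A).
Proof.
rewrite /basis_proj; set d := \row__ _.
have [|B ->] := @psd_diag_mx R _ d; last exact: psd_gram.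
by move=> a; rewrite mxE ler0n.
Qed.

Lemma basis_projE A :
  basis_proj A = \sum_(g in A) delta_mx (enum_rank g) (enum_rank g).
Proof.
apply/matrixP => a b; rewrite !mxE summxE.
under eq_bigr => g _ do rewrite mxE -(inj_eq enum_val_inj) enum_rankK.
rewrite (bigID (fun g => g == enum_val a)) /= addrC.
rewrite big1 ?add0r => [|g /andP[_ ga]]; last first.
  by rewrite eq_sym (negPf ga).
case: (boolP (enum_val a \in A)) => aA; last first.
  rewrite big1 ?mul0rn // => g /andP[gA /eqP ga].
  by rewrite ga (negPf aA) in gA.
rewrite (big_pred1 (enum_val a)) => [|g]; last first.
  by rewrite /= andbC; case: eqP => // ->.
by rewrite eqxx enum_valK [a == b]eq_sym; case: eqP.
Qed.

Lemma basis_projT : basis_proj setT = 1%:M.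
Proof. by apply/matrixP => a b; rewrite !mxE inE. Qed.

Lemma basis_projC A : 1%:M - basis_proj A = basis_proj (~: A).
Proof.
apply/matrixP => a b; rewrite !mxE inE; case: eqP => _; rewrite ?mulr0n ?subr0 //.
by case: (_ \in A); rewrite ?subrr ?subr0.
Qed.

Lemma basis_proj_mul A : basis_proj A *m basis_proj A = basis_proj A.
Proof.
rewrite mulmx_diag; congr diag_mx; apply/rowP => a; rewrite !mxE.
by case: (_ \in A); rewrite ?mulr1 ?mulr0.
Qed.

Lemma conj_act_basis_proj g A :
  conj_act (left_regular R) g (basis_proj A) = basis_proj (g *: A)%g.
Proof.
rewrite conj_act_left_regular; apply/matrixP => a b.
by rewrite !mxE (inj_eq (@left_index_inj g)) enum_rankK mem_lcoset.
Qed.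

Lemma tauE A : tau R A = #|A|%:R^-1 *: basis_proj A.
Proof. by rewrite basis_projE. Qed.

Lemma mxtrace_basis_proj A : \tr (basis_proj A) = #|A|%:R.
Proof.
rewrite basis_projE raddf_sum /= (eq_bigr (fun=> 1)) ?sumr_const // => g _.
by rewrite mxtrace_delta eqxx.
Qed.

Lemma invariant_tau (A : {group gT}) :
  invariant_state A (left_regular R) (tau R A).
Proof.
rewrite tauE; split=> [|g gA].
  split; first by apply: psdZ (psd_basis_proj A); rewrite invr_ge0 ler0n.
  by rewrite mxtraceZ mxtrace_basis_proj mulVf // pnatr_eq0 -lt0n cardG_gt0.
by rewrite conj_actZ conj_act_basis_proj lcoset_id.
Qed.

Lemma sum_basis_proj_lcosets (A : {group gT}) :
  \sum_(x in lcosets A [set: gT]) basis_proj x = 1%:M.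
Proof.
rewrite -basis_projT basis_projE.
rewrite (partition_big (fun g => g *: A)%g (mem (lcosets A [set: gT])))
  => [|g _] /=; last first.
  by apply/lcosetsP; exists g; rewrite ?inE.
apply: eq_bigr => _ /lcosetsP[h _ ->]; rewrite basis_projE.
by apply: eq_bigl => g; rewrite inE; apply/lcoset_eqP/eqP.
Qed.

End Symmetry.

Arguments basis_proj R {gT} A.

(** * Preparation, averaging, controlled channels, twirling and adjoints *)

Section Channels.
Variables (R : realType) (gT : finGroupType).
Local Notation C := (R[i]).
Local Open Scope complex_scope.

(** Adjoining a one-dimensional system only relabels the indices, so complete positivity is that of
    [mxsub]. *)
Lemma channel_tens1 n : channel (fun L : 'M[C]_n => (1%:M : 'M_1) *t L).
Proof.
split=> [c A B||L]; last by rewrite mxtrace_tens mxtrace1 mul1r.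
- by apply: blockP => i j; rewrite blockD blockZ !block_tens scalerDr !scalerA mulrC.
- apply: (cp_ext _ (cp_mxsub (fun x : 'I_(1 * n) => (mxtens.mxtens_unindex x).2))).
  by move=> L; apply/matrixP => x y; rewrite !mxE !ord1 eqxx mul1r.
Qed.

Lemma channel_prepare m n (A : 'M[C]_n) : state A ->
  channel (fun L : 'M[C]_m => \tr L *: A).
Proof.
move=> [A0 A1]; split=> [c K L||L].
- by rewrite mxtraceD mxtraceZ scalerDl scalerA.
- apply: (cp_ext _ (cp_measure_prepare (@psd1 R m) A0)) => L.
  by rewrite mul1mx.
- by rewrite mxtraceZ A1 mulr1.
Qed.

Lemma channel_average (I : finType) (i0 : I) m n (F : I -> 'M[C]_m -> 'M[C]_n) :
  (forall i, channel (F i)) -> channel (fun L => #|I|%:R^-1 *: \sum_i F i L).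
Proof.
move=> hF; split=> [c A B||L].
- rewrite [c *: (_ *: _)]scalerA [c * _]mulrC -scalerA -scalerDr; congr (_ *: _).
  rewrite scaler_sumr -big_split; apply: eq_bigr => i _.
  by have [-> _ _] := hF i.
- apply: cpZ; first by rewrite invr_ge0 ler0n.
  by apply: cp_sum => i _; have [] := hF i.
- rewrite mxtraceZ raddf_sum /= (eq_bigr (fun=> \tr L)) => [|i _]; last first.
    by have [_ _ ->] := hF i.
  rewrite sumr_const -[\tr L *+ _]mulr_natl mulKf // pnatr_eq0 -lt0n.
  by apply/card_gt0P; exists i0.
Qed.

Lemma channel_controlled (X : finType) (D : {set X}) p q n (M : X -> 'M[C]_n)
    (E : X -> 'M[C]_p -> 'M[C]_q) :
  povm D M -> (forall x, channel (E x)) ->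
  channel (fun L : 'M[C]_(p * n) => \sum_(x in D) E x (measured (M x) L)).
Proof.
move=> [M0 M1] hE; split=> [c A B||L].
- rewrite scaler_sumr -big_split; apply: eq_bigr => x _ /=.
  by have [lin _ _] := hE x; rewrite measured_is_linear lin.
- apply: cp_sum => x xD; have [_ cp _] := hE x.
  exact: cp_comp (cp_measured (M0 x xD)) cp.
- rewrite raddf_sum -(mxtrace_measured L M1); apply: eq_bigr => x _ /=.
  by have [_ _ ->] := hE x.
Qed.

Definition twirl m n (V : gT -> 'M[C]_m) (W : gT -> 'M[C]_n)
    (F : 'M[C]_m -> 'M[C]_n) (L : 'M[C]_m) : 'M[C]_n :=
  #|gT|%:R^-1 *: \sum_(g : gT) conj_act W g^-1%g (F (conj_act V g L)).

Lemma channel_twirl m n (V : gT -> 'M[C]_m) (W : gT -> 'M[C]_n) F :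
  proj_unitary_rep V -> proj_unitary_rep W -> channel F -> channel (twirl V W F).
Proof.
move=> hV hW hF; apply: (@channel_average gT 1%g) => g.
exact: channel_comp (channel_comp (channel_conj_act hV g) hF) (channel_conj_act hW _).
Qed.

(** The substitution of [h g^-1] for [h] in the average moves the group element from the input to
    the output. *)
Lemma covariant_twirl m n (V : gT -> 'M[C]_m) (W : gT -> 'M[C]_n) F :
  proj_unitary_rep V -> proj_unitary_rep W ->
  covariant [set: gT] V W (twirl V W F).
Proof.
move=> hV hW g _ L; rewrite /twirl conj_actZ conj_act_sum; congr (_ *: _).
rewrite (reindex_inj (mulIg g^-1)%g); apply: eq_bigr => h _ /=.
by rewrite !conj_actM // mulgKV invMg invgK.
Qed.

Lemma state_mixture n (A X : 'M[C]_n) (t : C) : state A -> state X ->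
  psd (X - t *: A) ->
  t <= 1 /\ exists2 B, state B & X = t *: A + (1 - t) *: B.
Proof.
move=> [A0 A1] [X0 X1] hXA.
have trXA : \tr (X - t *: A) = 1 - t by rewrite raddfB /= mxtraceZ X1 A1 mulr1.
have t1 : 0 <= 1 - t by rewrite -trXA psd_trace_ge0.
split; first by rewrite -subr_ge0.
have [t0|t0] := eqVneq (1 - t) 0.
  (* At [t = 1] the remainder is positive semidefinite of trace zero, hence zero, and any state can
     stand for [B]. *)
  exists A => //; rewrite t0 scale0r addr0.
  by apply/eqP; rewrite -subr_eq0; apply/eqP/psd_trace_eq0; rewrite ?trXA.
exists ((1 - t)^-1 *: (X - t *: A)).
  by split; [apply: psdZ; rewrite ?invr_ge0|rewrite mxtraceZ trXA mulVf].
by rewrite scalerA mulfV // scale1r addrC subrK.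
Qed.

(** This is the Heisenberg picture: the adjoint for the trace pairing inherits positivity from
    complete positivity, and trace preservation makes it carry resolutions of the identity to
    resolutions of the identity. *)
Lemma channel_adjoint m n (F : 'M[C]_m -> 'M[C]_n) : channel F ->
  exists Fd : 'M[C]_n -> 'M[C]_m,
    [/\ forall L P, \tr (L *m Fd P) = \tr (F L *m P),
        forall P, psd P -> psd (Fd P) &
        forall (X : finType) (D : {set X}) (P : X -> 'M[C]_n),
          \sum_(x in D) P x = 1%:M -> \sum_(x in D) Fd (P x) = 1%:M].
Proof.
move=> /channel_bundle [E [Ecp Etp] EF].
pose Fd P : 'M[C]_m := \matrix_(a, b) \tr (E (delta_mx b a) *m P).
have FdE L P : \tr (L *m Fd P) = \tr (E L *m P).
  rewrite [L in RHS]matrix_sum_delta linear_sum mulmx_suml raddf_sum.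
  apply: eq_bigr => b _; rewrite mxE linear_sum mulmx_suml raddf_sum.
  apply: eq_bigr => a _.
  by rewrite linearZ /= -scalemxAl mxtraceZ mxE.
exists Fd; split=> [L P|P P0 v|X D P P1]; first by rewrite FdE EF.
(* The quadratic form at [v] is the pairing of [Fd P] with the rank-one operator [v v^*], whose
   image under [E] is positive semidefinite. *)
- have -> : (v ^t* *m Fd P *m v)%sesqui 0 0 = \tr (v *m (v ^t*)%sesqui *m Fd P).
    by rewrite -trace_mx11 mxtrace_mulC mulmxA.
  have hv : psd (v *m (v ^t*)%sesqui) by rewrite -{1}[v]trmxCK; apply: psd_gram.
  by rewrite FdE; apply: (psd_trace_mul_ge0 (cp_psd Ecp hv) P0).
- apply/matrixP => a b; rewrite summxE.
  transitivity (\tr (E (delta_mx b a) *m \sum_(x in D) P x)).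
    by rewrite mulmx_sumr raddf_sum; apply: eq_bigr => x _; rewrite mxE.
  rewrite P1 mulmx1 Etp.
  by rewrite mxtrace_delta mxE eq_sym.
Qed.

Lemma outcome_probE n (A B : 'M[C]_n) : psd A -> psd B ->
  (outcome_prob A B)%:C = \tr (A *m B).
Proof.
by move=> hA hB; rewrite /outcome_prob RRe_real ?ger0_real ?psd_trace_mul_ge0.
Qed.

End Channels.

(** * Bounds by the orthogonal distinguishability function *)

Section OrthogonalDistinguishability.
Variable R : realType.
Variable Delta : forall d : nat, 'M[R[i]]_d -> 'M[R[i]]_d -> \bar R.
Variables (d0 : nat) (rho0 sigma0 : 'M[R[i]]_d0).
Local Open Scope complex_scope.
Local Notation f := (orth_dist_fun Delta rho0 sigma0).
Local Notation mix p := (p%:C *: rho0 + (1 - p)%:C *: sigma0).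
Hypothesis hinc : strictly_increasing_ge0 f.

Lemma orth_dist_fun_ln (p : R) : 0 < p ->
  f (- ln p)%:E = Delta rho0 (mix p).
Proof. by move=> p0; rewrite /orth_dist_fun /= opprK lnK. Qed.

(** The formula with [ln] covers positive weights only; weight zero is attained at infinity, where
    the exponential vanishes. *)
Lemma orth_dist_fun_pinfty : f +oo%E = Delta rho0 (mix 0).
Proof. by []. Qed.

Lemma oppr_ln_ge0 (p : R) : p <= 1 -> 0 <= - ln p.
Proof. by move=> p1; rewrite oppr_ge0 ln_le0. Qed.

Lemma ltr_oppr_ln (p q : R) : 0 < p -> p < q -> - ln q < - ln p.
Proof. by move=> p0 pq; rewrite ltrN2 ltr_ln // posrE (lt_trans p0). Qed.

Lemma mix_le_orth_dist (p q : R) : 0 < q -> q <= p -> p <= 1 ->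
  (Delta rho0 (mix p) <= f (- ln q)%:E)%E.
Proof.
move=> q0 qp p1; have p0 := lt_le_trans q0 qp.
rewrite -orth_dist_fun_ln //.
move: qp; rewrite le_eqVlt => /orP[/eqP -> //|qp].
by apply/ltW/hinc; rewrite ?lee_fin ?lte_fin ?oppr_ln_ge0 ?ltr_oppr_ln.
Qed.

(** By contraposition: [p < q] puts the argument belonging to [p] strictly above [- ln q], and
    strict monotonicity makes the distance exceed the bound. For [p = 0] that argument is [+oo]. *)
Lemma orth_dist_threshold (p q : R) : 0 < q -> q <= 1 -> 0 <= p ->
  (Delta rho0 (mix p) <= f (- ln q)%:E)%E -> q <= p.
Proof.
move=> q0 q1 p0; apply: contraTT; rewrite -ltNge -ltNge => pq.
have ln0 : (0 <= (- ln q)%:E)%E by rewrite lee_fin oppr_ln_ge0.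
move: p0 pq; rewrite le_eqVlt => /orP[/eqP <- _|p0 pq].
  by rewrite -orth_dist_fun_pinfty; apply: hinc => //; rewrite ltry.
by rewrite -orth_dist_fun_ln //; apply: hinc; rewrite // lte_fin ltr_oppr_ln.
Qed.

Hypothesis hDelta : distinguishability_measure Delta.
Hypothesis h0 : orthogonal_states rho0 sigma0.

Lemma dist_channel m n (F : 'M[R[i]]_m -> 'M[R[i]]_n) A B :
  channel F -> state A -> state B -> (Delta (F A) (F B) <= Delta A B)%E.
Proof.
move=> /channel_bundle [E hE EF] hA hB; rewrite -!EF.
exact: hDelta.2.
Qed.

(** The support projector of [rho0] separates the orthogonal pair perfectly, so preparing [A] or [B]
    according to its outcome carries one mixture to the other, and data processing applies. *)
Lemma dist_mixture n (A B : 'M[R[i]]_n) (p : R) : 0 <= p <= 1 ->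
  state A -> state B ->
  (Delta A (p%:C *: A + (1 - p)%:C *: B) <= Delta rho0 (mix p))%E.
Proof.
move=> /andP[p0 p1] hA hB; have [hr hs rs0] := h0.
have [P [P0 P1] [Pr Ps]] := orthogonal_test hr.1 rs0.
have hL := channel_measure_prepare P0 P1 hA hB.
set L := (fun _ => _) in hL.
have Lr : L rho0 = A.
  by rewrite /L mulmxBl mul1mx Pr subrr linear0 scale0r addr0 hr.2 scale1r.
have Ls : L sigma0 = B.
  by rewrite /L mulmxBl mul1mx Ps subr0 linear0 scale0r add0r hs.2 scale1r.
have [lin _ _] := hL.
have L0 : L 0 = 0 by rewrite /L !mulmx0 !linear0 !scale0r addr0.
(* The predicate [linear] speaks of [c *: A + B], so the second scalar is extracted after adding a
   zero term. *)
have Lmix : L (mix p) = p%:C *: A + (1 - p)%:C *: B.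
  by rewrite lin Lr -[_ *: sigma0]addr0 lin Ls L0 addr0.
have hmix : state (mix p).
  split; last by rewrite mxtraceD !mxtraceZ hr.2 hs.2 !mulr1 -rmorphD /= addrC subrK.
  have p0' : 0 <= p%:C by rewrite lecR.
  have p1' : 0 <= (1 - p)%:C by rewrite lecR subr_ge0.
  exact: psdD (psdZ p0' hr.1) (psdZ p1' hs.1).
by have := dist_channel hL hr hmix; rewrite Lr Lmix.
Qed.

End OrthogonalDistinguishability.

(** * The equivalence *)

Section Recovery.
Variables (R : realType) (gT : finGroupType).
Local Notation C := (R[i]).
Local Open Scope complex_scope.

(* Measure the reference system with [M]; on outcome [x = g *: S] apply [E]
   conjugated by [g], then twirl. *)
Lemma recovery_channel n (U : gT -> 'M[C]_n) (rho : 'M[C]_n) (S : {group gT})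
    (M : {set gT} -> 'M[C]_n) p q (UX : gT -> 'M[C]_p) (UY : gT -> 'M[C]_q)
    (E : 'M[C]_p -> 'M[C]_q) :
  proj_unitary_rep U -> state rho -> povm (lcosets S [set: gT]) M ->
  proj_unitary_rep UX -> proj_unitary_rep UY ->
  channel E -> covariant S UX UY E ->
  let t := #|gT|%:R^-1 * \sum_g \tr (M (g *: S)%g *m conj_act U g rho) in
  exists F : 'M[C]_(p * n) -> 'M[C]_q,
    [/\ channel F, covariant [set: gT] (tens_rep UX U) UY F &
      forall chi, state chi -> t <= 1 /\
        exists2 B, state B & F (chi *t rho) = t *: E chi + (1 - t) *: B].
Proof.
move=> hU hrho hM hX hY hE covE t.
pose Ex (x : {set gT}) := conj_act UY (repr x) \o (E \o conj_act UX (repr x)^-1%g).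
have hEx x : channel (Ex x).
  exact: channel_comp (channel_comp (channel_conj_act hX _) hE) (channel_conj_act hY _).
pose F0 L := \sum_(x in lcosets S [set: gT]) Ex x (measured (M x) L).
have hF0 : channel F0 := channel_controlled hM hEx.
have hXU := proj_unitary_rep_tens hX hU.
have hF := channel_twirl hXU hY hF0.
exists (twirl (tens_rep UX U) UY F0); split=> //; first exact: covariant_twirl.
move=> chi hchi; apply: state_mixture.
- exact: channel_state hchi.
- apply: channel_state => //; case: hchi => chi0 chi1; case: hrho => rho0 rho1.
  by split; [apply: psd_tens|rewrite mxtrace_tens chi1 rho1 mulr1].
pose c g x := \tr (M x *m conj_act U g rho).
pose w g x := conj_act UY g^-1%g (Ex x (conj_act UX g chi)).
have ExZ x a L : Ex x (a *: L) = a *: Ex x L.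
  have [lin _ _] := hEx x.
  have Ex0 : Ex x 0 = 0.
    by apply/eqP; have /eqP := lin (-1) 0 0; rewrite scaler0 addr0 scaleN1r addNr.
  by have := lin a L 0; rewrite Ex0 !addr0.
(* On the correct outcome the representative is [g * s] with [s] in [S]; undoing [g] leaves [E]
   conjugated by [s], which is [E] again by [S]-covariance. *)
have wE g : w g (g *: S)%g = E chi.
  rewrite /w /Ex /=.
  have /lcosetP[s sS ->] : repr (g *: S)%g \in (g *: S)%g.
    exact: mem_repr (lcoset_refl S g).
  rewrite !conj_actM // invMg mulgKV mulKg.
  by rewrite covE ?groupV // conj_actK.
(* Subtracting [t *: E chi] removes exactly the correct outcome from each term of the twirl; the
   wrong outcomes form a sum of states with nonnegative weights. *)
have -> : twirl (tens_rep UX U) UY F0 (chi *t rho) - t *: E chi = #|gT|%:R^-1 *: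
    \sum_g \sum_(x in lcosets S [set: gT] | x != (g *: S)%g) c g x *: w g x.
  rewrite /twirl /t -scalerA -scalerBr scaler_suml -sumrB; congr (_ *: _).
  apply: eq_bigr => g _; rewrite conj_act_tens /F0 conj_act_sum.
  rewrite (bigD1 (g *: S)%g) /=; last by apply/lcosetsP; exists g; rewrite ?inE.
  rewrite measured_tens ExZ conj_actZ -/(w g _) wE addrAC subrr add0r.
  apply: eq_bigr => x _.
  by rewrite measured_tens ExZ conj_actZ.
apply: psdZ; first by rewrite invr_ge0 ler0n.
apply: psd_sum => g _; apply: psd_sum => x /andP[xS _].
have cpg := channel_state (channel_conj_act hU g) hrho.
have hw : state (w g x).
  apply: channel_state (channel_conj_act hY _) _.
  apply: channel_state (hEx x) _.
  exact: channel_state (channel_conj_act hX _) hchi.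
exact: psdZ (psd_trace_mul_ge0 (hM.1 x xS) cpg.1) hw.1.
Qed.

Lemma average_outcome_probE n (U : gT -> 'M[C]_n) (rho : 'M[C]_n) (S : {set gT})
    (M : {set gT} -> 'M[C]_n) :
  proj_unitary_rep U -> state rho -> povm (lcosets S [set: gT]) M ->
  (#|gT|%:R^-1 * \sum_g outcome_prob (conj_act U g rho) (M (g *: S)%g))%:C =
  #|gT|%:R^-1 * \sum_g \tr (M (g *: S)%g *m conj_act U g rho).
Proof.
move=> hU hrho hM; rewrite rmorphM fmorphV rmorph_nat rmorph_sum; congr (_ * _).
apply: eq_bigr => g _; rewrite [RHS]mxtrace_mulC; apply: outcome_probE.
  by have [] := channel_state (channel_conj_act hU g) hrho.
by apply: hM.1; apply/lcosetsP; exists g; rewrite ?inE.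
Qed.

(* The adjoint of a covariant channel pulls the projective measurement of the
   coset back to a covariant POVM, so every outcome [g *: S] has the same
   probability on the rotated state. *)
Lemma covariant_povm n (U : gT -> 'M[C]_n) (rho : 'M[C]_n) (S : {group gT})
    (F : 'M[C]_n -> 'M[C]_#|gT|) :
  proj_unitary_rep U -> state rho -> channel F ->
  covariant [set: gT] U (left_regular R) F ->
  exists2 M : {set gT} -> 'M[C]_n, povm (lcosets S [set: gT]) M &
    forall g, (outcome_prob (conj_act U g rho) (M (g *: S)%g))%:C =
      \tr (basis_proj R S *m F rho).
Proof.
move=> hU hrho hF covF; have [Fd [FdE Fd0 Fd1]] := channel_adjoint hF.
exists (Fd \o basis_proj R) => [|g].
  split=> [x _|]; first exact/Fd0/psd_basis_proj.
  exact/Fd1/sum_basis_proj_lcosets.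
have hL := proj_unitary_rep_left_regular R gT.
rewrite outcome_probE; first last.
- exact/Fd0/psd_basis_proj.
- by have [] := channel_state (channel_conj_act hU g) hrho.
(* Covariance turns the rotation of [rho] into one of [F rho]; the projector onto [g *: S] is
   rotated by the same [g], which cancels in the trace. *)
rewrite /= FdE covF ?inE // -conj_act_basis_proj conj_act_mul //.
by rewrite mxtrace_conj_act // mxtrace_mulC.
Qed.

End Recovery.

(** * Estimates behind the individual implications *)

Section Implications.
Variables (R : realType) (gT : finGroupType).
Local Notation C := (R[i]).
Local Open Scope complex_scope.
Variables (n : nat) (U : gT -> 'M[C]_n) (rho : 'M[C]_n).
Hypotheses (hU : proj_unitary_rep U) (hrho : state rho).
Variable Delta : forall d : nat, 'M[C]_d -> 'M[C]_d -> \bar R.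
Hypothesis hDelta : distinguishability_measure Delta.
Variables (d0 : nat) (rho0 sigma0 : 'M[C]_d0).
Hypothesis h0 : orthogonal_states rho0 sigma0.
Local Notation f := (orth_dist_fun Delta rho0 sigma0).
Hypothesis hinc : strictly_increasing_ge0 f.

Lemma covariant_prepare (S : {set gT}) m (V : gT -> 'M[C]_m) sigma :
  invariant_state S V sigma ->
  covariant S (fun _ => 1%:M : 'M[C]_1) V (fun L => \tr L *: sigma).
Proof.
move=> [_ inv] g gS L; rewrite conj_actZ inv // mxtrace_conj_act //.
exact: proj_unitary_rep_trivial.
Qed.

(** The trivial system is absorbed by composing with [1 (x) -], which intertwines [U] with the
    tensor representation. *)
Lemma channel_on_reference m (V : gT -> 'M[C]_m)
    (F : {linear 'M[C]_(1 * n) -> 'M[C]_m}) :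
  cptp F -> covariant [set: gT] (tens_rep (fun _ => 1%:M : 'M[C]_1) U) V F ->
  exists G : {linear 'M[C]_n -> 'M[C]_m},
    [/\ cptp G, covariant [set: gT] U V G & G rho = F (1%:M *t rho)].
Proof.
move=> /cptp_channel hF covF.
have [G hG GE] := channel_bundle (channel_comp (channel_tens1 R n) hF).
exists G; split=> // g gT_ L; rewrite !GE /= -covF //.
by rewrite conj_act_tens /conj_act adjmx1 !mulmx1.
Qed.

Lemma regular_fidelity (S : {group gT}) (F : 'M[C]_n -> 'M[C]_#|gT|) (q : R) :
  0 < q -> q <= 1 -> channel F ->
  (Delta (tau R S) (F rho) <= f (- ln q)%:E)%E ->
  exists2 p : R, q <= p & p%:C = \tr (basis_proj R S *m F rho).
Proof.
move=> q0 q1 hF hD; have hFr := channel_state hF hrho.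
have hP : psd (basis_proj R S) := @psd_basis_proj R gT S.
have hP' : psd (1%:M - basis_proj R S) by rewrite basis_projC; apply: psd_basis_proj.
have [hr hs _] := h0.
have hL := channel_measure_prepare hP hP' hr hs.
set L := (fun _ => _) in hL.
have t0 := psd_trace_mul_ge0 hP hFr.1.
have tE : (complex.Re (\tr (basis_proj R S *m F rho)))%:C = \tr (basis_proj R S *m F rho).
  by rewrite RRe_real // ger0_real.
(* The witness is the probability that the regular system is found in [S]. *)
exists (complex.Re (\tr (basis_proj R S *m F rho))) => //.
set p := complex.Re _ in tE *.
have [htau _] := invariant_tau R S.
have Ptau : basis_proj R S *m tau R S = tau R S.
  by rewrite tauE -scalemxAr basis_proj_mul.
have Ltau : L (tau R S) = rho0.
  rewrite /L mulmxBl mul1mx Ptau subrr linear0 scale0r addr0.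
  by rewrite htau.2 scale1r.
have LF : L (F rho) = p%:C *: rho0 + (1 - p)%:C *: sigma0.
  by rewrite /L mulmxBl mul1mx raddfB /= hFr.2 -tE rmorphB rmorph1.
have p0 : 0 <= p by rewrite -lecR tE.
apply: (orth_dist_threshold hinc q0 q1 p0).
apply: le_trans hD.
by have := dist_channel hDelta hL htau hFr; rewrite Ltau LF.
Qed.

Lemma recovery_dist (S : {group gT}) (M : {set gT} -> 'M[C]_n) (q : R)
    k l (UX : gT -> 'M[C]_k) (UY : gT -> 'M[C]_l) (E : 'M[C]_k -> 'M[C]_l) :
  0 < q -> povm (lcosets S [set: gT]) M ->
  q <= #|gT|%:R^-1 * \sum_g outcome_prob (conj_act U g rho) (M (g *: S)%g) ->
  proj_unitary_rep UX -> proj_unitary_rep UY ->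
  channel E -> covariant S UX UY E ->
  exists F : 'M[C]_(k * n) -> 'M[C]_l,
    [/\ channel F, covariant [set: gT] (tens_rep UX U) UY F &
      forall chi, state chi ->
        (Delta (E chi) (F (chi *t rho)) <= f (- ln q)%:E)%E].
Proof.
move=> q0 hM; set p := _ * _ => qp hX hY hE covE.
have [F [hF covF HF]] := recovery_channel hU hrho hM hX hY hE covE.
exists F; split=> // chi hchi.
have [] := HF chi hchi; rewrite -average_outcome_probE // -/p => p1 [B hB ->].
have {}p1 : p <= 1 by rewrite -lecR rmorph1.
have p0 : 0 <= p := le_trans (ltW q0) qp.
have -> : 1 - p%:C = (1 - p)%:C by rewrite rmorphB rmorph1.
(* The success weight [p] may exceed [q]: the mixture is first compared at weight [p], then
   monotonicity passes to [q]. *)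
apply: (@le_trans _ _ (Delta rho0 (p%:C *: rho0 + (1 - p)%:C *: sigma0))).
  apply: dist_mixture => //; first by rewrite p0.
  exact: channel_state hchi.
exact: mix_le_orth_dist.
Qed.

End Implications.

Theorem theorem1 (R : realType) (gT : finGroupType) (n : nat)
    (U : gT -> 'M[R[i]]_n) (hU : proj_unitary_rep U)
    (rho : 'M[R[i]]_n) (hrho : state rho)
    (S : {set gT}) (hS : S = sym_subgroup U rho)
    (eps : R) (heps : 0 <= eps < 1)
    (Delta : forall d : nat, 'M[R[i]]_d -> 'M[R[i]]_d -> \bar R)
    (hDelta : distinguishability_measure Delta)
    (d0 : nat) (rho0 sigma0 : 'M[R[i]]_d0)
    (h0 : orthogonal_states rho0 sigma0)
    (f : \bar R -> \bar R) (hf : f = orth_dist_fun Delta rho0 sigma0)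
    (hinc : strictly_increasing_ge0 f) :
  [<-> forall (p q : nat) (UX : gT -> 'M[R[i]]_p) (UY : gT -> 'M[R[i]]_q),
         proj_unitary_rep UX -> proj_unitary_rep UY ->
         forall E : {linear 'M[R[i]]_p -> 'M[R[i]]_q},
         cptp E -> covariant S UX UY E ->
         exists F : {linear 'M[R[i]]_(p * n) -> 'M[R[i]]_q},
           [/\ cptp F, covariant [set: gT] (tens_rep UX U) UY F &
             forall chi : 'M[R[i]]_p, state chi ->
               (Delta q (E chi) (F (chi *t rho))
                  <= f (- ln (1 - eps))%:E)%E];
       forall (m : nat) (V : gT -> 'M[R[i]]_m) (sigma : 'M[R[i]]_m),
         proj_unitary_rep V -> invariant_state S V sigma ->
         exists F : {linear 'M[R[i]]_n -> 'M[R[i]]_m},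
           [/\ cptp F, covariant [set: gT] U V F &
             (Delta m sigma (F rho) <= f (- ln (1 - eps))%:E)%E];
       exists F : {linear 'M[R[i]]_n -> 'M[R[i]]_#|gT|},
         [/\ cptp F, covariant [set: gT] U (left_regular R) F &
           (Delta #|gT| (tau R S) (F rho) <= f (- ln (1 - eps))%:E)%E];
       exists M : {set gT} -> 'M[R[i]]_n,
         povm (lcosets S [set: gT]) M /\
         1 - eps <=
           min_over_group (fun g => outcome_prob (conj_act U g rho) (M (g *: S)%g));
       exists M : {set gT} -> 'M[R[i]]_n,
         povm (lcosets S [set: gT]) M /\
         1 - eps <= #|gT|%:R^-1 *
           \sum_(g : gT) outcome_prob (conj_act U g rho) (M (g *: S)%g)].
Proof.
have [eps0 eps1] := andP heps.
have q0 : 0 < 1 - eps by rewrite subr_gt0.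
have q1 : 1 - eps <= 1 by rewrite lerBlDr lerDl.
have gS : group_set S by rewrite hS; apply: group_set_sym_subgroup.
pose SG := Group gS; have SE : S = SG by [].
(* The equivalence is proved as a cycle, so five implications remain. *)
rewrite {}hf in hinc *; do 5?split.
- move=> hi m V sigma hV hsigma.
  (* An invariant state is an [S]-covariant preparation from the one-dimensional system with trivial
     representation. *)
  have [E hE EE] := channel_bundle (channel_prepare 1 hsigma.1).
  have covE : covariant S (fun _ => 1%:M) V E.
    by move=> g gS' L; rewrite !EE; apply: (covariant_prepare hsigma gS').
  have [F [hF covF HF]] := hi _ _ _ _ (proj_unitary_rep_trivial R gT 1) hV E hE covE.
  have [G [hG covG GE]] := channel_on_reference rho hF covF.
  exists G; split=> //; rewrite GE.
  have h1 : state (1%:M : 'M[R[i]]_1) by split; [apply: psd1|rewrite mxtrace1].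
  by have := HF _ h1; rewrite EE mxtrace1 scale1r.
- move=> hii; apply: hii; first exact: proj_unitary_rep_left_regular.
  by rewrite SE; apply: invariant_tau.
- move=> [F [/cptp_channel hF covF hD]].
  have [p qp pE] := regular_fidelity hrho hDelta h0 hinc (S := SG) q0 q1 hF hD.
  have [M hM ME] := covariant_povm SG hU hrho hF covF.
  have Mp g : outcome_prob (conj_act U g rho) (M (g *: S)%g) = p.
    by have := ME g; rewrite -pE => -[].
  exists M; split=> //.
  rewrite /min_over_group.
  (* The base value of the iterated minimum is the probability at the identity, so it equals [p] as
     well. *)
  by elim/big_ind: _ => [|x y hx hy|g _]; rewrite ?Mp // le_min hx.
- move=> [M [hM hmin]]; exists M; split=> //.
  set p := fun g => _ in hmin.
  have hp g : 1 - eps <= p g.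
    by apply: le_trans hmin _; apply: bigmin_le_cond.
  rewrite mulrC ler_pdivlMr ?ltr0n; last by apply/card_gt0P; exists 1%g.
  by rewrite mulr_natr -sumr_const; apply: ler_sum => g _; apply: hp.
- move=> [M [hM hav]] k l UX UY hX hY E /cptp_channel hE covE.
  have [F [hF covF HF]] :=
    recovery_dist hU hrho hDelta h0 hinc (S := SG) q0 hM hav hX hY hE covE.
  have [G hG GE] := channel_bundle hF.
  exists G; split=> // [g gT_ L|chi hchi]; first by rewrite !GE covF.
  by rewrite GE; apply: HF.
Qed.
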